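(* Let $P=\{p_1,\dots,p_n\}$ be a finite set, let $r\ge 2$, and let $\mathcal{P}=\{\leq_a: a\in[r-1]\}$ be a family of partial order relations on $P$ such that for every $a\in[r-1]$, $p_i\leq_a p_j$ implies $i\le j$. Then the set of minimal monomial generators of the Alexander dual $H_r(\mathcal{P})^{\vee}$ is exactly $$\{X_{s,i}X_{t,j} : 1\le s<t\le r,\ i,j\in[n],\ p_i\leq_{[s,t-1]}p_j\}.$$
   Context: ${\sf k}$ is a field, $[m]=\{1,\dots,m\}$, $S={\sf k}[X_{a,i}: a\in[r], i\in[n]]$ is the polynomial ring in distinct variables of degree $1$, and $V=\{X_{a,i}: a\in[r], i\in[n]\}$. For $a\in[r-1]$ let $P_a=(P,\leq_a)$. A poset ideal of $P_a$ is a subset $I\subset P$ (possibly empty) such that $p\in I$, $q\in P$ and $q\leq_a p$ imply $q\in I$. $J(P_a)$ is the set of poset ideals of $P_a$. $K_r(\mathcal{P})$ is the set of tuples $\mathbf{I}=(I_1,\dots,I_{r-1})$ with $I_a\in J(P_a)$ for all $a$ and $I_{r-1}\subset\cdots\subset I_1$ (inclusions not necessarily strict). For $\mathbf{I}\in K_r(\mathcal{P})$ put $u_{\mathbf{I}}=u_{I_1}\cdots u_{I_{r-1}}$, where $u_{I_a}=\prod_{p_i\in I_a}X_{a,i}\prod_{p_i\in P\setminus I_a}X_{a+1,i}$. $H_r(\mathcal{P})$ is the squarefree monomial ideal of $S$ generated by all $u_{\mathbf{I}}$, $\mathbf{I}\in K_r(\mathcal{P})$. For $1\le a\le b\le r-1$,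 the relation $\leq_{[a,b]}$ on $P$ is defined by: $p_i\leq_{[a,b]}p_j$ if there is a non-decreasing sequence $(t_1,\dots,t_k)$ of indices in $[n]$, with $k=b-a$, such that $p_i\leq_a p_{t_1}\leq_{a+1}\cdots\leq_{b-1}p_{t_k}\leq_b p_j$; for $a=b$ this means $p_i\leq_a p_j$. Alexander dual: for a simplicial complex $\Delta$ on $V$ (a family of subsets of $V$ containing $\emptyset$ and closed under taking subsets; singletons are not required to be faces), the Stanley-Reisner ideal $I_\Delta$ is generated by the monomials $\prod_{x\in F}x$ with $F$ a minimal nonface of $\Delta$; the Alexander dual complex is $\Delta^\vee=\{V\setminus F: F\subset V \text{ a nonface of }\Delta\}$; and $I_\Delta^\vee:=I_{\Delta^\vee}$. $H_r(\mathcal{P})^\vee$ is $I_\Delta^\vee$ for the complex $\Delta$ with $I_\Delta=H_r(\mathcal{P})$. *)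

(* Defs.v *)
From mathcomp Require Import all_boot all_order all_algebra.
From mathcomp Require Import mpoly.

Set Implicit Arguments.
Unset Strict Implicit.
Unset Printing Implicit Defensive.

Import GRing.Theory.
Local Open Scope ring_scope.

(* Ideals and, more generally, subsets of a ring are predicates [R -> Prop]. *)
Definition ideal_gen (R : comNzRingType) (G : R -> Prop) (f : R) : Prop :=
  exists (m : nat) (c g : 'I_m -> R),
    (forall l, G (g l)) /\ f = \sum_(l < m) c l * g l.

Definition same_set (R : Type) (A B : R -> Prop) : Prop :=
  forall f, A f <-> B f.

Section Monomials.
Variables (k : fieldType) (T : finType).

(* The polynomial ring over k in variables indexed by the finite type T. *)
Local Notation polyring := {mpoly k[#|T|]}.

Definition Xvar (x : T) : polyring := 'X_(enum_rank x).

Definition is_monomial (f : polyring) : Prop :=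
  exists m : 'X_{1..#|T|}, f = 'X_[m].

Definition monomial_generators (I G : polyring -> Prop) : Prop :=
  (forall g, G g -> is_monomial g) /\ same_set (ideal_gen G) I.

(* G is the smallest set of monomials generating I; a least element for
   inclusion is unique, so this speaks of _the_ minimal monomial generators. *)
Definition minimal_monomial_generators (I G : polyring -> Prop) : Prop :=
  monomial_generators I G /\
  (forall G', monomial_generators I G' -> forall g, G g -> G' g).

Definition simplicial_complex (D : {set {set T}}) : Prop :=
  set0 \in D /\ (forall F G : {set T}, F \in D -> G \subset F -> G \in D).

Definition minimal_nonface (D : {set {set T}}) (F : {set T}) : bool :=
  minset [pred G : {set T} | G \notin D] F.

Definition Stanley_Reisner (D : {set {set T}}) : polyring -> Prop :=
  ideal_gen (fun f : polyring => exists2 F : {set T},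
    minimal_nonface D F & f = \prod_(x in F) Xvar x).

Definition dual_complex (D : {set {set T}}) : {set {set T}} :=
  [set ~: F | F : {set T} in ~: D].

(* The complex D with Stanley_Reisner D = I is unique if it exists, and then
   this is the ideal Stanley_Reisner (dual_complex D).  If there is no such D
   (e.g. for I the unit ideal, as a complex contains set0) it is the zero
   ideal, which agrees with the usual convention for the unit ideal. *)
Definition Alexander_dual (I : polyring -> Prop) : polyring -> Prop :=
  ideal_gen (fun f : polyring => exists D : {set {set T}},
    [/\ simplicial_complex D, same_set (Stanley_Reisner D) I
      & Stanley_Reisner (dual_complex D) f]).

End Monomials.

(* [r] and [r-1] are rendered 0-based as 'I_r and 'I_r.-1: the index a in
   [r-1] gives the indices a and a+1 of [r], i.e. [idx_lo a] and [idx_hi a]. *)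
Definition idx_lo (r : nat) (a : 'I_r.-1) : 'I_r := widen_ord (leq_pred r) a.

Definition idx_hi (r : nat) (a : 'I_r.-1) : 'I_r :=
  Ordinal (etrans (esym (ltn_predRL a r)) (ltn_ord a)).

Section Hibi.
Variables (k : fieldType) (r n : nat) (P : finType) (p : 'I_n -> P).
Variable le : 'I_r.-1 -> rel P.

Definition partial_order (R : rel P) : Prop :=
  [/\ reflexive R, antisymmetric R & transitive R].

Local Notation ringS := {mpoly k[#|{: 'I_r * 'I_n}|]}.

Definition X (a : 'I_r) (i : 'I_n) : ringS := Xvar k (a, i).

Definition poset_ideal (R : rel P) (I : {set P}) : bool :=
  [forall x in I, forall y, R y x ==> (y \in I)].

Definition Kr : {set {ffun 'I_r.-1 -> {set P}}} :=
  [set I : {ffun 'I_r.-1 -> {set P}} |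
    [forall a, poset_ideal (le a) (I a)]
    && [forall a : 'I_r.-1, forall b : 'I_r.-1,
          (a <= b)%N ==> (I b \subset I a)]].

Definition u (I : {ffun 'I_r.-1 -> {set P}}) : ringS :=
  \prod_(a < r.-1)
    ((\prod_(i < n | p i \in I a) X (idx_lo a) i)
     * (\prod_(i < n | p i \notin I a) X (idx_hi a) i)).

Definition Hr : ringS -> Prop :=
  ideal_gen (fun f : ringS => exists2 I, I \in Kr & f = u I).

(* p_i <=_[a,b] p_j for a <= b; in the chain s = (i, t_1, ..., t_(b-a), j) the
   step from position c - a to the next one uses the order with index c. *)
Definition interval_le (a b : nat) (i j : 'I_n) : Prop :=
  exists t : (b - a).-tuple 'I_n,
    sorted leq [seq val x | x <- t] /\
    let s := i :: rcons t j in
    forall c : 'I_r.-1, (a <= c <= b)%N ->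
      le c (p (nth i s (c - a))) (p (nth i s (c - a).+1)).

End Hibi.

Arguments X k {r n} a i.
Arguments Hr k {r n P} p le _.

(* Main.v *)
Require Import Defs.
From mathcomp Require Import all_boot all_order all_algebra.
From mathcomp Require Import mpoly.

Set Implicit Arguments.
Unset Strict Implicit.
Unset Printing Implicit Defensive.

Import GRing.Theory.
Local Open Scope ring_scope.

(** Why the theorem holds; rows and columns are counted from 0.  For I in K_r
    the ideals I_a decrease with a, so in the column i of the variables the
    monomial u_I misses exactly one variable, X_{m(i),i}, where m(i) is the
    number of a with p_i in I_a.  Hence u_I is the product of the variables
    outside the graph of m ([u_sqfree]), and the Alexander dual of H_r is the
    Stanley-Reisner ideal of the complex whose faces are the subsets of these
    graphs.

    This complex is a flag complex.  Call (s,i), (t,j) a chain pair when s < t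
    and p_i <=_[s,t-1] p_j.  A graph contains no chain pair: m(j) = t puts p_j
    in I_{t-1}; going down the chain, each step stays in an ideal because I_c is
    a poset ideal and passes to the next order because I_c is inside I_{c-1};
    one ends with p_i in I_s, against m(i) = s ([chain_in_ideal]).  Conversely,
    if F contains no chain pair, let I_a be the set of all p_i such that
    p_i <=_[a,t-1] p_j for some (t,j) in F with a < t.  These sets form an
    element of K_r ([down_ideals_Kr]), and F lies in the graph of its function m
    ([avoid_supp_u]).  So the minimal nonfaces are the chain pairs
    ([Alexander_dual_flag]).

    The resulting generators are monomials, all of degree 2, and monomials of
    one and the same degree belong to every monomial generating set of the ideal
    that they generate ([equigenerated_minimal]). *)

(** * Ideals generated by a set *)

Section IdealGen.
Variable R : comNzRingType.
Implicit Types (G H : R -> Prop) (f g : R).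

Lemma ideal_gen_incl G g : G g -> ideal_gen G g.
Proof.
move=> Gg; exists 1%N, (fun=> 1), (fun=> g); split=> //.
by rewrite big_ord1 mul1r.
Qed.

Lemma ideal_gen0 G : ideal_gen G 0.
Proof.
exists 0%N, (fun=> 0), (fun=> 0); split; first by case.
by rewrite big_ord0.
Qed.

Lemma ideal_genD G f g :
  ideal_gen G f -> ideal_gen G g -> ideal_gen G (f + g).
Proof.
move=> [m1 [c1 [g1 [Gg1 ->]]]] [m2 [c2 [g2 [Gg2 ->]]]].
pose glue (h1 : 'I_m1 -> R) (h2 : 'I_m2 -> R) (l : 'I_(m1 + m2)) :=
  match split l with inl a => h1 a | inr b => h2 b end.
exists (m1 + m2)%N, (glue c1 c2), (glue g1 g2); split.
  by move=> l; rewrite /glue; case: split.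
rewrite big_split_ord /=; congr (_ + _); apply: eq_bigr => l _.
  by rewrite /glue -[lshift _ l]/(unsplit (inl l)) unsplitK.
by rewrite /glue -[rshift _ l]/(unsplit (inr l)) unsplitK.
Qed.

Lemma ideal_genM G c f : ideal_gen G f -> ideal_gen G (c * f).
Proof.
move=> [m [d [g [Gg ->]]]]; exists m, (fun l => c * d l), g; split=> //.
by rewrite mulr_sumr; apply: eq_bigr => l _; rewrite mulrA.
Qed.

Lemma ideal_gen_min G H :
  (forall g, G g -> ideal_gen H g) -> forall f, ideal_gen G f -> ideal_gen H f.
Proof.
move=> GH f [m [c [g [Gg ->]]]].
apply: (big_ind (ideal_gen H)); first exact: ideal_gen0.
  exact: ideal_genD.
by move=> l _; apply/ideal_genM/GH.
Qed.

Lemma same_set_ideal_gen G H :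
  same_set G H -> same_set (ideal_gen G) (ideal_gen H).
Proof.
by move=> eqGH f; split; apply: ideal_gen_min => g /eqGH; apply: ideal_gen_incl.
Qed.

End IdealGen.

(** * Monomial ideals *)

Section MonomialIdeals.
Variables (k : fieldType) (N : nat).
Local Notation ring := {mpoly k[N]}.
Implicit Types (m : 'X_{1..N}) (G : ring -> Prop).

Lemma mpolyX_inj : injective (fun m => 'X_[m] : ring).
Proof. by move=> m m' /(congr1 (@msupp _ _)); rewrite !msuppX => -[]. Qed.

Lemma mcoeff_mulX_neq0 (c : ring) m m' : (c * 'X_[m'])@_m != 0 -> (m' <= m)%MM.
Proof.
apply: contraNT => lemN; rewrite [c]mpolyE mulr_suml raddf_sum big1 //= => a _.
rewrite -scalerAl -mpolyXD mcoeffZ mcoeffX; case: eqP => [em|_]; last first.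
  by rewrite mulr0.
by case/negP: lemN; rewrite -em lem_addl.
Qed.

(** A monomial of the ideal has a nonzero coefficient in some term of its
    expression by the generators, so that one generator divides it. *)
Lemma mem_monomial_ideal G m :
    (forall g, G g -> exists m, g = 'X_[m]) ->
  ideal_gen G 'X_[m] <-> exists2 m', G 'X_[m'] & (m' <= m)%MM.
Proof.
move=> Gmon; split=> [[d [c [g [Gg def_m]]]] | [m' Gm' le_m'm]]; last first.
  by rewrite -(submK le_m'm) mpolyXD; apply/ideal_genM/ideal_gen_incl.
have : 'X_[m]@_m != 0 :> k by rewrite mcoeffX eqxx oner_neq0.
rewrite def_m raddf_sum /= => nz.
have [l nz_l] : exists l, (c l * g l)@_m != 0.
  apply/existsP; apply: contraNT nz; rewrite negb_exists => /forallP all0.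
  by rewrite big1 // => l _; apply/eqP; move: (all0 l); rewrite negbK.
have [m' def_g] := Gmon _ (Gg l); exists m'; first by rewrite -def_g.
by apply: (@mcoeff_mulX_neq0 (c l)); rewrite -def_g.
Qed.

Lemma mnm_le_mdeg_eq m m' : (m' <= m)%MM -> (mdeg m <= mdeg m')%N -> m' = m.
Proof.
move=> le_m'm; rewrite -{1}(submK le_m'm) mdegD -{2}[mdeg m']add0n leq_add2r.
by rewrite leqn0 mdeg_eq0 => /eqP dm0; rewrite -(submK le_m'm) dm0 add0m.
Qed.

(** A generator g in G is divisible by some g' in G', which is itself divisible
    by some g'' in G; since g'' and g have the same degree, all three agree. *)
Lemma equigenerated_minimal d G G' :
    (forall g, G g -> exists2 m, g = 'X_[m] & mdeg m = d) ->
    (forall g, G' g -> exists m, g = 'X_[m]) ->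
    same_set (ideal_gen G') (ideal_gen G) ->
  forall g, G g -> G' g.
Proof.
move=> Gd G'mon eqI g Gg; have [m def_g deg_m] := Gd g Gg.
have Gmon h : G h -> exists m, h = 'X_[m] by case/Gd=> a; exists a.
have : ideal_gen G' 'X_[m] by apply/eqI/ideal_gen_incl; rewrite -def_g.
case/(mem_monomial_ideal _ G'mon) => m' G'm' le_m'm.
have : ideal_gen G 'X_[m'] by apply/eqI/ideal_gen_incl.
case/(mem_monomial_ideal _ Gmon) => m2 Gm2 le_m2m'.
have deg_m2 : mdeg m2 = d.
  by have [m3 /mpolyX_inj ->] := Gd _ Gm2.
have m2E : m2 = m.
  by apply: mnm_le_mdeg_eq; rewrite ?deg_m ?deg_m2 // (lepm_trans le_m2m').
rewrite def_g; suff <- : m' = m by [].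
by apply: mnm_le_mdeg_eq => //; rewrite -m2E -(submK le_m2m') mdegD leq_addl.
Qed.

End MonomialIdeals.

(** * Stanley-Reisner ideals and flag complexes *)

Section SquarefreeIdeals.
Variables (k : fieldType) (T : finType).
Local Notation ring := {mpoly k[#|T|]}.
Implicit Types (E F : {set T}) (D : {set {set T}}) (B : pred {set T}).

Definition sqfree F : ring := \prod_(x in F) Xvar k x.

Definition sqfree_gens B (f : ring) : Prop := exists2 F, B F & f = sqfree F.

Definition supp_mnm F : 'X_{1..#|T|} := (\sum_(x in F) U_(enum_rank x))%MM.

Lemma sqfreeE F : sqfree F = 'X_[supp_mnm F].
Proof. exact: mprodXE. Qed.

Lemma supp_mnmE F x : supp_mnm F (enum_rank x) = (x \in F).
Proof.
rewrite mnm_sumE.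
under eq_bigr => y _ do rewrite mnm1E (inj_eq enum_rank_inj).
case: (boolP (x \in F)) => [xF | xNF].
  by rewrite (bigD1 x) //= eqxx big1 // => y /andP[_ /negPf->].
by rewrite big1 // => y yF; case: eqP => // eq_yx; rewrite -eq_yx yF in xNF.
Qed.

Lemma supp_mnm_le E F : (supp_mnm E <= supp_mnm F)%MM = (E \subset F).
Proof.
apply/mnm_lepP/subsetP => [le_EF x xE | sEF i].
  by move: (le_EF (enum_rank x)); rewrite !supp_mnmE xE; case: (x \in F).
rewrite -(enum_valK i) !supp_mnmE; case xE: (_ \in E) => //.
by rewrite (sEF _ xE).
Qed.

Lemma sqfree_gens_monomial B g : sqfree_gens B g -> exists m, g = 'X_[m].
Proof. by case=> F _ ->; exists (supp_mnm F); apply: sqfreeE. Qed.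

Lemma mem_sqfree_ideal B F :
  ideal_gen (sqfree_gens B) (sqfree F) <-> exists2 E, B E & E \subset F.
Proof.
rewrite sqfreeE; split.
  case/(mem_monomial_ideal _ (@sqfree_gens_monomial B)) => m [E BE].
  by rewrite sqfreeE => /mpolyX_inj-> leEF; exists E; rewrite // -supp_mnm_le.
case=> E BE sEF; apply/(mem_monomial_ideal _ (@sqfree_gens_monomial B)).
by exists (supp_mnm E); rewrite ?supp_mnm_le //; exists E; rewrite ?sqfreeE.
Qed.

Lemma Stanley_Reisner_sqfree D F :
  simplicial_complex D -> Stanley_Reisner D (sqfree F) <-> F \notin D.
Proof.
case=> _ Dclosed; split.
  case/mem_sqfree_ideal=> E /minsetp/= END sEF.
  by apply: contra END => FD; apply: Dclosed sEF.
move=> FND; have [E minE sEF] := @minset_exists _ [pred G | G \notin D] F FND.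
by apply/mem_sqfree_ideal; exists E.
Qed.

(** The squarefree monomials of a Stanley-Reisner ideal are those of the
    nonfaces, hence the ideal determines the complex.  This makes the choice of
    the complex in [Alexander_dual] harmless. *)
Lemma Stanley_Reisner_eqP D B :
    simplicial_complex D ->
  same_set (Stanley_Reisner D) (ideal_gen (sqfree_gens B)) <->
  (forall F, F \notin D <-> exists2 E, B E & E \subset F).
Proof.
move=> cD; split=> [eqI F | nonface f].
  by rewrite -mem_sqfree_ideal -eqI Stanley_Reisner_sqfree.
split; apply: ideal_gen_min => _ [F FB ->].
  by apply/mem_sqfree_ideal/nonface; apply: minsetp FB.
by apply/(Stanley_Reisner_sqfree _ cD)/nonface; exists F.
Qed.

Definition has_pair (bad : rel T) : pred {set T} :=
  [pred F : {set T} | [exists x in F, exists y in F, bad x y]].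

Lemma has_pairP (bad : rel T) F :
  reflect (exists x y, [/\ x \in F, y \in F & bad x y]) (has_pair bad F).
Proof.
apply: (iffP exists_inP) => [[x xF /exists_inP[y yF bxy]] |].
  by exists x, y.
by case=> x [y [xF yF bxy]]; exists x => //; apply/exists_inP; exists y.
Qed.

(** By irreflexivity every bad pair has two elements, so that none contains
    another. *)
Lemma minset_pairs (bad : rel T) F :
    irreflexive bad ->
  minset (has_pair bad) F <-> exists x y, bad x y /\ F = [set x; y].
Proof.
move=> bad_irr; split=> [/minsetP[/has_pairP[x [y [xF yF bxy]]] minF] |].
  exists x, y; split=> //; apply/esym/minF; last first.
    by rewrite subUset !sub1set xF yF.
  by apply/has_pairP; exists x, y; rewrite set21 set22.
case=> x [y [bxy ->]]; apply/minsetP; split=> [|G].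
  by apply/has_pairP; exists x, y; rewrite set21 set22.
case/has_pairP=> x' [y' [x'G y'G bxy']] sG; apply/eqP; rewrite eqEcard sG /=.
have -> : #|[set x; y]| = #|[set x'; y']|.
  have neq z t : bad z t -> z != t by case: eqP => // ->; rewrite bad_irr.
  by rewrite !cards2 !neq.
by apply: subset_leq_card; rewrite subUset !sub1set x'G y'G.
Qed.

Definition pair_gens (bad : rel T) (f : ring) : Prop :=
  exists x y, bad x y /\ f = Xvar k x * Xvar k y.

Lemma sqfree_pair x y : x != y -> sqfree [set x; y] = Xvar k x * Xvar k y.
Proof. by move=> neq_xy; rewrite /sqfree big_setU1 ?big_set1 // inE. Qed.

Lemma dual_complexE D F : (F \in dual_complex D) = (~: F \notin D).
Proof.
apply/imsetP/idP=> [[G] | cFND].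
  by rewrite inE => GND ->; rewrite setCK.
by exists (~: F); rewrite ?inE ?setCK.
Qed.

Lemma Stanley_Reisner_flag D (bad : rel T) :
    irreflexive bad -> (forall F, (F \notin D) = has_pair bad F) ->
  same_set (Stanley_Reisner D) (ideal_gen (pair_gens bad)).
Proof.
move=> bad_irr nonface.
have pairE x y : bad x y -> sqfree [set x; y] = Xvar k x * Xvar k y.
  move=> bxy; apply: sqfree_pair.
  by apply: contraTneq bxy => ->; rewrite bad_irr.
have minE F : minimal_nonface D F = minset (has_pair bad) F.
  exact: minset_eq.
move=> f; split; apply: ideal_gen_min => g.
  case=> F; rewrite minE => /(minset_pairs _ bad_irr)[x [y [bxy ->]]] ->.
  by apply: ideal_gen_incl; exists x, y; split; rewrite // -pairE.
case=> x [y [bxy ->]]; apply: ideal_gen_incl; exists [set x; y].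
  by rewrite minE; apply/(minset_pairs _ bad_irr); exists x, y.
exact/esym/pairE.
Qed.

Lemma same_set_Alexander_dual (I J : ring -> Prop) :
  same_set I J -> same_set (Alexander_dual I) (Alexander_dual J).
Proof.
move=> eqIJ; apply: same_set_ideal_gen => f.
by split=> -[D [cD SRD df]]; exists D; split=> // g; rewrite SRD eqIJ.
Qed.

(** The Stanley-Reisner complex D of the ideal consists of the F containing no
    member of B; so F is a face of the dual complex exactly if some member of B
    is disjoint from F, and the hypothesis says that the dual is flag. *)
Lemma Alexander_dual_flag B (bad : rel T) :
    irreflexive bad ->
    (forall F, (exists2 E, B E & [disjoint E & F]) <-> ~~ has_pair bad F) ->
  same_set (Alexander_dual (ideal_gen (sqfree_gens B)))
           (ideal_gen (pair_gens bad)).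
Proof.
move=> bad_irr flag.
have dualSR D : simplicial_complex D ->
    same_set (Stanley_Reisner D) (ideal_gen (sqfree_gens B)) ->
    same_set (Stanley_Reisner (dual_complex D)) (ideal_gen (pair_gens bad)).
  move=> cD /(Stanley_Reisner_eqP _ cD) nonface.
  apply: Stanley_Reisner_flag => // F.
  rewrite dual_complexE; apply: negb_inj; rewrite negbK.
  apply/idP/idP => [/nonface[E BE sE] | /flag[E BE dE]].
    by apply/flag; exists E; rewrite // disjoints_subset.
  by apply/nonface; exists E; rewrite // -disjoints_subset.
move=> f; split; apply: ideal_gen_min => g.
  by case=> D [cD SRD dg]; apply/(dualSR D cD SRD).
move=> [x [y [bxy def_g]]].
(* If B contained the empty set, the ideal would be the unit ideal, which has
   no complex at all; one bad pair rules this out. *)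
have BN0 : ~~ B set0.
  have bad_T : has_pair bad setT by apply/has_pairP; exists x, y; rewrite !inE.
  apply: contraL bad_T => B0; apply/flag.
  by exists set0; rewrite // disjoints_subset sub0set.
pose D := [set F : {set T} | ~~ [exists E : {set T}, B E && (E \subset F)]].
have cD : simplicial_complex D.
  split.
    rewrite inE; apply: contra BN0 => /existsP[E /andP[BE]].
    by rewrite subset0 => /eqP <-.
  move=> F G; rewrite !inE => FD sGF.
  apply: contra FD => /existsP[E /andP[BE sEG]].
  by apply/existsP; exists E; rewrite BE (subset_trans sEG).
have SRD : same_set (Stanley_Reisner D) (ideal_gen (sqfree_gens B)).
  apply/(Stanley_Reisner_eqP _ cD) => F; rewrite inE negbK; split.
    by case/existsP=> E /andP[BE sEF]; exists E.
  by case=> E BE sEF; apply/existsP; exists E; rewrite BE.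
apply: ideal_gen_incl; exists D; split=> //; apply/(dualSR D cD SRD).
by apply: ideal_gen_incl; exists x, y.
Qed.

End SquarefreeIdeals.

(** * The monomials u_I as complements of graphs *)

Section GraphComplements.
Variables (k : fieldType) (r n : nat) (P : finType) (p : 'I_n -> P).
Variable le : 'I_r.-1 -> rel P.
Implicit Types (I : {ffun 'I_r.-1 -> {set P}}) (F : {set 'I_r * 'I_n}).

(** The index pair of the variable that the pair (a, i) contributes to u_I. *)
Definition slot I (x : 'I_r.-1 * 'I_n) : 'I_r * 'I_n :=
  (if p x.2 \in I x.1 then idx_lo x.1 else idx_hi x.1, x.2).

Definition supp_u I : {set 'I_r * 'I_n} := [set slot I x | x in setT].

Lemma KrP I :
  reflect ((forall a x y, x \in I a -> le a y x -> y \in I a) /\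
           (forall a b : 'I_r.-1, (a <= b)%N -> I b \subset I a))
          (I \in Kr le).
Proof.
rewrite inE; apply: (iffP andP) => -[idealI decI]; split.
- move=> a x y xI yx.
  have /forall_inP/(_ x xI)/forallP/(_ y) := forallP idealI a.
  by rewrite yx.
- by move=> a b; move/forallP/(_ a)/forallP/(_ b)/implyP: decI.
- apply/forallP=> a; apply/forall_inP=> x xI; apply/forallP=> y; apply/implyP.
  exact: idealI.
- by apply/forallP=> a; apply/forallP=> b; apply/implyP/decI.
Qed.

(** This says that u_I is squarefree.  Two factors in the same column i could
    coincide only as the upper choice at a and the lower choice at a + 1, that
    is, with p_i in I_{a+1} but not in I_a. *)
Lemma slot_inj I : I \in Kr le -> injective (slot I).
Proof.
case/KrP=> _ decI.
have noninc (a b : 'I_r.-1) i : (a < b)%N -> slot I (a, i) <> slot I (b, i).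
  move=> ltab [] /(congr1 val) /=; case: ifP => [_|piN]; case: ifP => /= piI.
  - by move=> eq_ab; rewrite eq_ab ltnn in ltab.
  - by move=> eq_ab; rewrite eq_ab ltnNge leqnSn in ltab.
  - by rewrite (subsetP (decI _ _ (ltnW ltab)) _ piI) in piN.
  - by case=> eq_ab; rewrite eq_ab ltnn in ltab.
move=> [a i] [b j] eq_slot; have eq_ij : i = j by case: eq_slot.
rewrite -eq_ij in eq_slot *; congr (_, _); apply: val_inj => /=.
by case: (ltngtP a b) => // /noninc; [move/(_ i)|move/(_ i)/nesym].
Qed.

Lemma u_sqfree I : I \in Kr le -> u k p I = sqfree k (supp_u I).
Proof.
move=> KI; rewrite /sqfree big_imset /=; last first.
  by move=> x y _ _; apply: slot_inj.
rewrite (eq_bigl predT) => [|x]; last by rewrite inE.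
rewrite -(pair_big predT predT (fun a i => Xvar k (slot I (a, i)))) /=.
apply: eq_bigr => a _; rewrite [RHS](bigID (fun i => p i \in I a)) /=.
by congr (_ * _); apply: eq_bigr => i piI; rewrite /slot /= ?piI ?(negPf piI).
Qed.

Lemma Hr_sqfree :
  same_set (Hr k p le)
    (ideal_gen (sqfree_gens (fun E => E \in [set supp_u I | I in Kr le]))).
Proof.
apply: same_set_ideal_gen => f; split.
  case=> I KI ->; exists (supp_u I); last exact: u_sqfree KI.
  exact: imset_f.
by case=> _ /imsetP[I KI ->] ->; exists I; rewrite // (u_sqfree KI).
Qed.

Lemma disjoint_supp_u I F :
  reflect (forall a i, [/\ (idx_lo a, i) \in F -> p i \notin I a
                         & (idx_hi a, i) \in F -> p i \in I a])
          [disjoint supp_u I & F].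
Proof.
rewrite disjoint_sym disjoints_subset.
apply: (iffP subsetP) => [sF a i | avoid x xF].
  split=> /sF; rewrite inE.
    apply: contraNN => piI; apply/imsetP; exists (a, i) => //.
    by rewrite /slot piI.
  apply: contraNT => piI; apply/imsetP; exists (a, i) => //.
  by rewrite /slot (negPf piI).
rewrite inE; apply/imsetP=> -[[a i] _]; have [lo hi] := avoid a i.
rewrite /slot /=; case: ifP => piI def_x.
  by move: (lo); rewrite -def_x piI => /(_ xF).
by move: (hi); rewrite -def_x piI => /(_ xF).
Qed.

(** * Chains of the interval relations *)

(** A chain is indexed here by the rows s, ..., t themselves, and extended by
    arbitrary values to all rows.  A fixed finite function type makes the
    relation decidable and lets a chain be modified at one end without
    reindexing. *)
Definition chain_steps (s t : 'I_r) (g : {ffun 'I_r -> 'I_n}) : bool :=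
  [forall c : 'I_r.-1, (s <= c < t)%N ==>
     le c (p (g (idx_lo c))) (p (g (idx_hi c)))].

Definition chain (s t : 'I_r) (i j : 'I_n) : bool :=
  [exists g : {ffun 'I_r -> 'I_n},
     [&& g s == i, g t == j & chain_steps s t g]].

Lemma chainP (s t : 'I_r) i j :
  reflect (exists g : {ffun 'I_r -> 'I_n}, [/\ g s = i, g t = j &
             forall c : 'I_r.-1, (s <= c < t)%N ->
               le c (p (g (idx_lo c))) (p (g (idx_hi c)))])
          (chain s t i j).
Proof.
apply: (iffP existsP) => -[g].
  case/and3P=> /eqP gs /eqP gt /forallP pathg; exists g; split=> // c.
  exact/implyP.
case=> gs gt pathg; exists g; apply/and3P; split; try exact/eqP.
by apply/forallP=> c; apply/implyP/pathg.
Qed.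

Hypothesis le_refl : forall a, reflexive (le a).
Hypothesis le_trans : forall a, transitive (le a).

Lemma chain_refl s t i : chain s t i i.
Proof.
by apply/chainP; exists [ffun=> i]; split=> [||c _]; rewrite !ffunE ?le_refl.
Qed.

Lemma chain_prepend (a : 'I_r.-1) (t : 'I_r) i i' j :
  (a < t)%N -> le a (p i') (p i) -> chain (idx_lo a) t i j ->
  chain (idx_lo a) t i' j.
Proof.
move=> lt_at le_i'i /chainP[g [ga gt pathg]]; apply/chainP.
exists [ffun c => if c == idx_lo a then i' else g c]; split.
- by rewrite ffunE eqxx.
- by rewrite ffunE; case: eqP => // t_a; rewrite t_a /= ltnn in lt_at.
move=> c act; rewrite !ffunE.
have hiN : idx_hi c == idx_lo a = false.
  by apply/negbTE; rewrite -val_eqE /= gtn_eqF //; case/andP: act.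
rewrite hiN; case: eqP => [|_]; last exact: pathg.
move/(congr1 val) => /= /val_inj eq_ca; rewrite {c act hiN}eq_ca.
apply: le_trans le_i'i _; rewrite -ga; apply: pathg.
by rewrite /= leqnn.
Qed.

(** Since the orders are reflexive, a chain can be continued downwards by its
    own starting point. *)
Lemma chain_extend (s s' t : 'I_r) i j :
  (s' <= s <= t)%N -> chain s t i j -> chain s' t i j.
Proof.
case/andP=> le_s's le_st /chainP[g [gs gt pathg]]; apply/chainP.
exists [ffun c : 'I_r => if (c < s)%N then i else g c]; split.
- rewrite ffunE; case: ltnP => // le_ss'.
  by rewrite -gs; congr (g _); apply/val_inj/eqP; rewrite eqn_leq le_s's.
- by rewrite ffunE ltnNge le_st.
move=> c /andP[_ lt_ct]; rewrite !ffunE /=.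
case: ltnP => [lt_cs | le_sc]; last by rewrite ltnNge leqW //= pathg ?le_sc.
case: ltnP => [_ | le_sc']; first exact: le_refl.
have -> : idx_hi c = s by apply/val_inj/eqP; rewrite eqn_leq /= lt_cs.
by rewrite gs; apply: le_refl.
Qed.

Hypothesis le_label : forall a i j, le a (p i) (p j) -> (i <= j)%N.

(** The monotonicity required of the sequence of indices in [interval_le] comes
    for free, because the labelling is a linear extension of every order. *)
Lemma interval_leP (s t : 'I_r) i j :
  (s < t)%N -> interval_le p le s t.-1 i j <-> chain s t i j.
Proof.
move=> lt_st; have t_gt0 : (0 < t)%N by apply: leq_ltn_trans lt_st.
have le_ct c : (c <= t.-1)%N = (c < t)%N by rewrite -ltnS prednK.
split=> [[w [_ /= le_w]] | /chainP[g [gs gt pathg]]].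
  apply/chainP; exists [ffun c : 'I_r => nth i (i :: rcons w j) (c - s)]; split.
  - by rewrite ffunE subnn.
  - have def_ts : (t - s = (t.-1 - s).+1)%N by rewrite -subSn ?le_ct ?prednK.
    by rewrite ffunE def_ts /= nth_rcons size_tuple ltnn eqxx.
  move=> c /andP[le_sc lt_ct]; rewrite !ffunE /= subSn //.
  by apply: le_w; rewrite le_sc le_ct.
(* h m is the entry of the chain in row s + m; the default value s of [insubd]
   is reached only beyond the last row. *)
pose h m := g (insubd s (s + m)%N).
have hE m (c : 'I_r) : (s + m = c)%N -> h m = g c.
  move=> def_c; congr (g _); apply: val_inj.
  by rewrite val_insubd def_c ltn_ord.
have step m (c : 'I_r.-1) :
    (s + m = c)%N -> (c < t)%N -> le c (p (h m)) (p (h m.+1)).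
  move=> def_c lt_ct; rewrite (hE m (idx_lo c)) // (hE m.+1 (idx_hi c)).
    by apply: pathg; rewrite lt_ct -def_c leq_addr.
  by rewrite addnS def_c.
have [w wE] : exists w : (t.-1 - s).-tuple 'I_n,
    forall l, (l < t.-1 - s)%N -> nth i w l = h l.+1.
  exists [tuple h l.+1 | l < t.-1 - s] => l lt_l.
  by rewrite -[l]/(val (Ordinal lt_l)) -tnth_nth tnth_mktuple.
have nth_w m : (m <= (t.-1 - s).+1)%N -> nth i (i :: rcons w j) m = h m.
  case: m => [_|m]; first by rewrite (hE 0%N s) ?addn0.
  rewrite ltnS /= nth_rcons size_tuple leq_eqVlt => /orP[/eqP-> | lt_m].
    by rewrite ltnn eqxx (hE _ t) // addnS subnKC ?prednK // -ltnS prednK.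
  by rewrite lt_m wE.
exists w; split; last first.
  move=> walk c /andP[le_sc]; rewrite le_ct => lt_ct; rewrite /walk !nth_w.
  - by apply: step; rewrite ?subnKC.
  - by rewrite ltnS leq_sub2r // le_ct.
  - by rewrite leqW // leq_sub2r // le_ct.
apply/(sortedP 0%N) => m; rewrite size_map size_tuple => lt_m.
have nthE l : (l < t.-1 - s)%N -> nth 0%N [seq val x | x <- w] l = h l.+1.
  by move=> lt_l; rewrite (nth_map i) ?size_tuple // wE.
rewrite !nthE //; last exact: ltnW.
have lt_smt : (s + m.+1 < t)%N.
  by rewrite -le_ct; rewrite ltn_subRL in lt_m; apply: ltnW.
have lt_c : (s + m.+1 < r.-1)%N by rewrite ltn_predRL (leq_ltn_trans lt_smt).
by apply: (@le_label (Ordinal lt_c) (h m.+1) (h m.+2)); apply: step.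
Qed.

(** * The minimal nonfaces of the dual complex *)

Definition chain_pair : rel ('I_r * 'I_n) :=
  [rel x y : 'I_r * 'I_n | (x.1 < y.1)%N && chain x.1 y.1 x.2 y.2].

Lemma chain_pair_irr : irreflexive chain_pair.
Proof. by move=> x; rewrite /chain_pair /= ltnn. Qed.

Lemma chain_in_ideal I (s t : 'I_r) i j :
    I \in Kr le -> (s < t)%N -> chain s t i j ->
    (forall c : 'I_r.-1, idx_hi c = t -> p j \in I c) ->
  forall a : 'I_r.-1, idx_lo a = s -> p i \in I a.
Proof.
case/KrP=> idealI decI ltst /chainP[g [gs gt pathg]] It a a_s.
(* The chain is descended from t, so the induction is on the distance to t. *)
have descend d (c : 'I_r.-1) :
    (t - c.+1 = d)%N -> (s <= c < t)%N -> p (g (idx_lo c)) \in I c.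
  elim: d c => [|d IHd] c def_d sct; apply: (idealI _ _ _ _ (pathg _ sct)).
    have tE : idx_hi c = t.
      apply/val_inj/eqP; rewrite /= eqn_leq; case/andP: sct => _ ->.
      by rewrite -subn_eq0 def_d.
    by rewrite tE gt It.
  have lt_c't : (c.+1 < t)%N by rewrite -subn_gt0 def_d.
  have lt_c' : (c.+1 < r.-1)%N.
    by rewrite ltn_predRL; apply: leq_ltn_trans lt_c't (ltn_ord t).
  have -> : idx_hi c = idx_lo (Ordinal lt_c') by apply: val_inj.
  apply: (subsetP (decI c (Ordinal lt_c') _)); first by rewrite /= leqnSn.
  apply: IHd; first by rewrite /= subnS def_d.
  by rewrite /= lt_c't andbT leqW //; case/andP: sct.
have := descend _ a erefl; rewrite a_s gs; apply.
by rewrite -a_s /= leqnn /= in ltst *.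
Qed.

Variable q : P -> 'I_n.
Hypotheses (pK : cancel p q) (qK : cancel q p).

(** The least member of K_r whose graph can contain F: having (t, j) in the
    graph forces p_j into I_{t-1}, hence into I_a everything below p_j along a
    chain from row a to row t. *)
Definition down_ideals F : {ffun 'I_r.-1 -> {set P}} :=
  [ffun a : 'I_r.-1 => [set x | [exists y in F,
     (a < y.1)%N && chain (idx_lo a) y.1 (q x) y.2]]].

Lemma down_idealsP F (a : 'I_r.-1) x :
  reflect (exists t j,
             [/\ (t, j) \in F, (a < t)%N & chain (idx_lo a) t (q x) j])
          (x \in down_ideals F a).
Proof.
rewrite ffunE inE; apply: (iffP exists_inP) => [[[t j] yF /andP[lt_at ch]] | ].
  by exists t, j.
by case=> t [j [yF lt_at ch]]; exists (t, j); rewrite ?lt_at.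
Qed.

Lemma down_ideals_Kr F : down_ideals F \in Kr le.
Proof.
apply/KrP; split=> [a x y | a b le_ab].
  case/down_idealsP=> t [j [tjF lt_at ch]] le_yx.
  apply/down_idealsP; exists t, j; split=> //.
  by apply: chain_prepend ch; rewrite // !qK.
apply/subsetP=> x /down_idealsP[t [j [tjF lt_bt ch]]]; apply/down_idealsP.
exists t, j; split; rewrite ?(leq_ltn_trans le_ab) //.
by apply: chain_extend ch; rewrite /= le_ab ltnW.
Qed.

(** To be disjoint from the support of u_I is to lie in the graph of I.  For F
    without chain pairs the witness is [down_ideals F]: if (t, j) is in F, then
    p_j is in I_{t-1} by a constant chain, while p_j in I_t would mean a chain
    pair of (t, j) with another element of F. *)
Lemma avoid_supp_u F :
  (exists2 E, E \in [set supp_u I | I in Kr le] & [disjoint E & F]) <->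
  ~~ has_pair chain_pair F.
Proof.
split=> [[_ /imsetP[I KI ->] /disjoint_supp_u avoid] | noF].
  apply/has_pairP=> -[[s i] [[t j] [siF tjF /andP[/= lt_st ch]]]].
  have lt_s : (s < r.-1)%N by rewrite ltn_predRL (leq_ltn_trans lt_st).
  have loE : idx_lo (Ordinal lt_s) = s by apply: val_inj.
  have [lo _] := avoid (Ordinal lt_s) i.
  rewrite loE in lo; move/negP: (lo siF); apply.
  apply: (chain_in_ideal KI lt_st ch) => // c hiE.
  by have [_] := avoid c j; rewrite hiE; apply.
exists (supp_u (down_ideals F)).
  by apply/imsetP; exists (down_ideals F); rewrite ?down_ideals_Kr.
apply/disjoint_supp_u=> a i; split=> xF.
  apply: contra noF => /down_idealsP[t [j [tjF lt_at]]]; rewrite pK => ch.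
  apply/has_pairP; exists (idx_lo a, i), (t, j); split=> //.
  by rewrite /chain_pair /= lt_at.
apply/down_idealsP; exists (idx_hi a), i; rewrite pK /=; split=> //.
exact: chain_refl.
Qed.

End GraphComplements.

Theorem theorem4p4 (k : fieldType) (n r : nat) (hr : (2 <= r)%N)
    (P : finType) (p : 'I_n -> P) (p_bij : bijective p)
    (le : 'I_r.-1 -> rel P)
    (le_po : forall a : 'I_r.-1, partial_order (le a))
    (le_label : forall (a : 'I_r.-1) (i j : 'I_n),
       le a (p i) (p j) -> (i <= j)%N) :
  minimal_monomial_generators
    (Alexander_dual (Hr k p le))
    (fun f => exists (s t : 'I_r) (i j : 'I_n),
       [/\ (s < t)%N, interval_le p le s t.-1 i j & f = X k s i * X k t j]).
Proof.
set G := (fun f => exists s t i j, _).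
have le_refl a : reflexive (le a) by case: (le_po a).
have le_trans a : transitive (le a) by case: (le_po a).
have [q pK qK] := p_bij.
have GE : same_set G (pair_gens (chain_pair p le)).
  move=> f; split.
    case=> [s [t [i [j [lt_st st_ij ->]]]]]; exists (s, i), (t, j); split=> //.
    by rewrite /chain_pair /= lt_st; apply/interval_leP.
  case=> [[s i] [[t j] [/andP[/= lt_st ch] ->]]]; exists s, t, i, j; split=> //.
  exact/interval_leP.
have dualE : same_set (ideal_gen G) (Alexander_dual (Hr k p le)).
  move=> f; rewrite (same_set_ideal_gen GE).
  rewrite (same_set_Alexander_dual (@Hr_sqfree k r n P p le)).
  have flag := avoid_supp_u le_refl le_trans pK qK.
  by rewrite (Alexander_dual_flag (@chain_pair_irr _ _ _ p le) flag).
have Gdeg2 f : G f -> exists2 m, f = 'X_[m] & mdeg m = 2.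
  case=> [s [t [i [j [_ _ ->]]]]]; rewrite /X /Xvar -mpolyXD.
  by eexists; first by []; rewrite mdegD !mdeg1.
split; first split=> // f.
  by case/Gdeg2=> m fE _; exists m.
move=> G' [G'mon G'E]; apply: equigenerated_minimal Gdeg2 G'mon _ => f.
by rewrite G'E dualE.
Qed.
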